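(* Let $k\ge 2$ be an integer and $\sigma^2>0$. Let $X_1,\dots,X_k$ be real-valued random variables with finite second moments (the values of one fixed weight coordinate in the $k$ model instances), and let $$S^2=\frac{1}{k-1}\sum_{u=1}^k\Bigl(X_u-\tfrac1k\textstyle\sum_{v=1}^k X_v\Bigr)^2$$ be their unbiased sample variance. Assume $\mathbb E[S^2]=\frac{k}{2}\sigma^2$. Perform one ''draw and discard'' update: choose an index $j$ uniformly at random from $\{1,\dots,k\}$, choose an index $l$ uniformly at random from $\{1,\dots,k\}$ (with $j$, $l$ independent of each other and of everything else), draw a noise variable $r$ independent of $(X_1,\dots,X_k,j,l)$ with $\mathbb E[r]=0$ and $\mathrm{Var}(r)=\sigma^2$, and define new values $X'_l=X_j+r$ and $X'_u=X_u$ for $u\neq l$. Then the unbiased sample variance $S'^2$ of $X'_1,\dots,X'_k$ satisfies $\mathbb E[S'^2]=\frac{k}{2}\sigma^2$. Consequently, applying the update repeatedly (with fresh independent $j,l,r$ each time), the expected intra-model sample variance stays equal to $\frac{k}{2}\sigma^2$ after any number of updates; the same holds coordinatewise for vector-valued weights $B=(B_1,\dots,B_p)$ with per-coordinate noise variances $\sigma_i^2$.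
   Context: This models the server side of ''Draw and Discard'' machine learning: the server keeps $k$ instances of a model; at each step a uniformly random instance is sent to a client, which returns it with independent zero-mean noise added (variance $\sigma^2$ per coordinate), and the returned model overwrites a uniformly random one of the $k$ instances (possibly the one that was drawn). *)

(* Defs.v *)
(* No measure theory is installed, so
   an expectation is modelled abstractly as a normalised, positive, linear
   functional [E] on a class [Int] of integrable random variables. *)
From Stdlib Require Import Reals Lra.
Open Scope R_scope.

Fixpoint sumR (n : nat) (f : nat -> R) : R :=
  match n with
  | O => 0
  | S m => sumR m f + f m
  end.

Record IsExpectation {Omega : Type} (Int : (Omega -> R) -> Prop)
    (E : (Omega -> R) -> R) : Prop := {
  int_const : forall c : R, Int (fun _ => c);
  int_add : forall f g, Int f -> Int g -> Int (fun w => f w + g w);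
  int_scal : forall (c : R) f, Int f -> Int (fun w => c * f w);
  E_const : forall c : R, E (fun _ => c) = c;
  E_add : forall f g, Int f -> Int g -> E (fun w => f w + g w) = E f + E g;
  E_scal : forall (c : R) f, Int f -> E (fun w => c * f w) = c * E f;
  E_nonneg : forall f, Int f -> (forall w, 0 <= f w) -> 0 <= E f
}.

Definition mean (k : nat) (x : nat -> R) : R := / INR k * sumR k x.

Definition sample_var (k : nat) (x : nat -> R) : R :=
  / (INR k - 1) * sumR k (fun u => (x u - mean k x) ^ 2).

Definition dd_update (x : nat -> R) (j l : nat) (r : R) : nat -> R :=
  fun u => if Nat.eqb u l then x j + r else x u.

(* Main.v *)
(* Both the copy and the noise change one coordinate, and adding t to
   coordinate l changes S^2 by 2 t (x_l - mean)/(k-1) + t^2/k.  Averaged over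
   the copy j -> l this contracts the sample variance by the factor 1 - 2/k^2,
   while the centred noise adds exactly Var(r)/k.  Hence
     E[S'^2] = (1 - 2/k^2) E[S^2] + sigma^2/k,
   whose unique fixed point is E[S^2] = k sigma^2 / 2. *)
Require Import Defs.
From Stdlib Require Import Reals Lra Lia FunctionalExtensionality.
Open Scope R_scope.

Lemma sumR_ext n f g :
  (forall i, (i < n)%nat -> f i = g i) -> sumR n f = sumR n g.
Proof.
  induction n as [|n IH]; intros Hfg; cbn [sumR]; [reflexivity|].
  rewrite IH by (intros; apply Hfg; lia).
  rewrite (Hfg n) by lia; reflexivity.
Qed.

Lemma sumR_plus n f g : sumR n (fun i => f i + g i) = sumR n f + sumR n g.
Proof. induction n as [|n IH]; cbn [sumR]; [ring|]. rewrite IH; ring. Qed.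

Lemma sumR_scal_l n c f : sumR n (fun i => c * f i) = c * sumR n f.
Proof. induction n as [|n IH]; cbn [sumR]; [ring|]. rewrite IH; ring. Qed.

Lemma sumR_const n c : sumR n (fun _ => c) = INR n * c.
Proof. induction n as [|n IH]; cbn [sumR]; [simpl; ring|]. rewrite IH, S_INR; ring. Qed.

Lemma sumR_mult n f g :
  sumR n f * sumR n g = sumR n (fun u => sumR n (fun v => f u * g v)).
Proof.
  rewrite Rmult_comm, <- sumR_scal_l.
  apply sumR_ext; intros u _.
  rewrite sumR_scal_l; ring.
Qed.

Lemma sumR_plus_indicator n f l a :
  (l < n)%nat ->
  sumR n (fun u => f u + if Nat.eqb u l then a else 0) = sumR n f + a.
Proof.
  intros Hl.
  assert (Hgen : forall m, sumR m (fun u => f u + if Nat.eqb u l then a else 0)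
                           = sumR m f + if Nat.ltb l m then a else 0).
  { induction m as [|m IH]; cbn [sumR]; [simpl; ring|].
    rewrite IH.
    destruct (Nat.eqb_spec m l), (Nat.ltb_spec l m), (Nat.ltb_spec l (S m));
      try lia; ring. }
  rewrite Hgen; destruct (Nat.ltb_spec l n); [ring | lia].
Qed.

Lemma sumR_sumR_quadratic n a b d e (c : nat -> R) :
  sumR n (fun j => sumR n (fun l => a * c j ^ 2 + b * c j * c l + d * c l ^ 2 + e))
  = INR n * (a + d) * sumR n (fun u => c u ^ 2) + b * sumR n c ^ 2 + INR n * INR n * e.
Proof.
  rewrite (sumR_ext n _ (fun j => INR n * a * c j ^ 2 + (b * sumR n c) * c j
                                  + (d * sumR n (fun u => c u ^ 2) + INR n * e))).
  - rewrite !sumR_plus, !sumR_scal_l, !sumR_const; ring.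
  - intros j _.
    rewrite (sumR_ext n _ (fun l => (b * c j) * c l + d * c l ^ 2 + (a * c j ^ 2 + e)))
      by (intros; ring).
    rewrite !sumR_plus, !sumR_scal_l, !sumR_const; ring.
Qed.

Lemma INR_neq0_pred_neq0 k : (1 < k)%nat -> INR k <> 0 /\ INR k - 1 <> 0.
Proof. intros Hk; pose proof (lt_1_INR k Hk); split; lra. Qed.

Lemma sample_var_sum_sq k x :
  INR k <> 0 ->
  sample_var k x
  = / (INR k - 1) * (sumR k (fun u => x u ^ 2) - / INR k * sumR k x ^ 2).
Proof.
  intros Hk; unfold sample_var, mean; f_equal.
  rewrite (sumR_ext k _ (fun u => x u ^ 2 + (-2 * (/ INR k * sumR k x)) * x u
                                  + (/ INR k * sumR k x) ^ 2)) by (intros; ring).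
  rewrite !sumR_plus, sumR_scal_l, sumR_const; field; exact Hk.
Qed.

Definition add_at (x : nat -> R) (l : nat) (t : R) : nat -> R :=
  fun u => if Nat.eqb u l then x u + t else x u.

Lemma sample_var_add_at k x l t :
  (1 < k)%nat -> (l < k)%nat ->
  sample_var k (add_at x l t)
  = sample_var k x + 2 * t * (x l - mean k x) / (INR k - 1) + t ^ 2 / INR k.
Proof.
  intros Hk Hl; destruct (INR_neq0_pred_neq0 k Hk) as [HK HK1].
  assert (Hsum : sumR k (add_at x l t) = sumR k x + t).
  { rewrite <- (sumR_plus_indicator k x l t Hl).
    apply sumR_ext; intros u _; unfold add_at.
    destruct (Nat.eqb u l); ring. }
  assert (Hsq : sumR k (fun u => add_at x l t u ^ 2)
                = sumR k (fun u => x u ^ 2) + (2 * t * x l + t ^ 2)).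
  { rewrite <- (sumR_plus_indicator k _ l _ Hl).
    apply sumR_ext; intros u _; unfold add_at.
    destruct (Nat.eqb_spec u l); [subst; ring | ring]. }
  rewrite !sample_var_sum_sq, Hsum, Hsq by exact HK.
  unfold mean; field; split; assumption.
Qed.

Lemma dd_update_as_add_at x j l t : dd_update x j l t = add_at (dd_update x j l 0) l t.
Proof.
  apply functional_extensionality; intros u; unfold dd_update, add_at.
  destruct (Nat.eqb u l); ring.
Qed.

Lemma dd_update0_as_add_at x j l : dd_update x j l 0 = add_at x l (x j - x l).
Proof.
  apply functional_extensionality; intros u; unfold dd_update, add_at.
  destruct (Nat.eqb_spec u l); [subst; ring | reflexivity].
Qed.

Lemma avg_sample_var_copy k x :
  (1 < k)%nat ->
  / INR k * sumR k (fun j => / INR k * sumR k (fun l => sample_var k (dd_update x j l 0)))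
  = (1 - 2 / INR k ^ 2) * sample_var k x.
Proof.
  intros Hk; destruct (INR_neq0_pred_neq0 k Hk) as [HK HK1].
  set (K := INR k) in *.
  set (c := fun u => x u - mean k x).
  assert (Hc1 : sumR k c = 0).
  { unfold c; rewrite (sumR_ext k _ (fun u => x u + -1 * mean k x)) by (intros; ring).
    rewrite sumR_plus, sumR_const; unfold mean; fold K; field; exact HK. }
  assert (Hc2 : sumR k (fun u => c u ^ 2) = (K - 1) * sample_var k x).
  { unfold sample_var, c; fold K; field; exact HK1. }
  rewrite (sumR_ext k _ (fun j => / K * sumR k (fun l =>
             / K * c j ^ 2 + (2 / (K - 1) - 2 / K) * c j * c l
             + (/ K - 2 / (K - 1)) * c l ^ 2 + sample_var k x))).
  - rewrite sumR_scal_l, sumR_sumR_quadratic, Hc1, Hc2; fold K.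
    field; split; assumption.
  - intros j Hj; f_equal; apply sumR_ext; intros l Hl.
    rewrite dd_update0_as_add_at, sample_var_add_at by assumption.
    unfold c; fold K; field; split; assumption.
Qed.

Section Expectation.

Variables (Omega : Type) (Int : (Omega -> R) -> Prop) (E : (Omega -> R) -> R).
Hypothesis HE : IsExpectation Int E.

Lemma int_sumR n (F : nat -> Omega -> R) :
  (forall i, (i < n)%nat -> Int (F i)) -> Int (fun w => sumR n (fun i => F i w)).
Proof.
  induction n as [|n IH]; intros HF; cbn [sumR].
  - apply (int_const _ _ HE).
  - apply (int_add _ _ HE); [apply IH; intros; apply HF | apply HF]; lia.
Qed.

Lemma int_sample_var k (X : Omega -> nat -> R) :
  (forall u v, (u < k)%nat -> (v < k)%nat -> Int (fun w => X w u * X w v)) ->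
  (1 < k)%nat -> Int (fun w => sample_var k (X w)).
Proof.
  intros HXX Hk; destruct (INR_neq0_pred_neq0 k Hk) as [HK _].
  assert (Hsv : (fun w => sample_var k (X w))
                = fun w => / (INR k - 1) * (sumR k (fun u => X w u * X w u)
                    + - / INR k * sumR k (fun u => sumR k (fun v => X w u * X w v)))).
  { apply functional_extensionality; intros w.
    rewrite sample_var_sum_sq, <- sumR_mult by exact HK.
    rewrite (sumR_ext k (fun u => X w u ^ 2) (fun u => X w u * X w u)) by (intros; ring).
    ring. }
  rewrite Hsv.
  apply (int_scal _ _ HE), (int_add _ _ HE).
  - apply (int_sumR k (fun u w => X w u * X w u)); auto.
  - apply (int_scal _ _ HE), (int_sumR k (fun u w => sumR k (fun v => X w u * X w v))).
    intros u Hu; apply (int_sumR k (fun v w => X w u * X w v)); auto.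
Qed.

Lemma E_affine a b f : Int f -> E (fun w => a * f w + b) = a * E f + b.
Proof.
  intros Hf.
  rewrite (E_add _ _ HE), (E_scal _ _ HE), (E_const _ _ HE); auto.
  - apply (int_scal _ _ HE); exact Hf.
  - apply (int_const _ _ HE).
Qed.

Lemma E_quadratic a b c f :
  Int f -> Int (fun w => f w ^ 2) ->
  E (fun w => a + b * f w + c * f w ^ 2) = a + b * E f + c * E (fun w => f w ^ 2).
Proof.
  intros Hf Hf2.
  assert (Hlin : Int (fun w => b * f w + a)) by
    (apply (int_add _ _ HE); [apply (int_scal _ _ HE); exact Hf | apply (int_const _ _ HE)]).
  transitivity (E (fun w => (b * f w + a) + c * f w ^ 2)).
  { f_equal; apply functional_extensionality; intros w; ring. }
  rewrite (E_add _ _ HE), E_affine, (E_scal _ _ HE) by (try apply (int_scal _ _ HE); assumption).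
  ring.
Qed.

Lemma E_sample_var_dd_update k x j l (r : Omega -> R) :
  (1 < k)%nat -> (l < k)%nat -> Int r -> Int (fun w => r w ^ 2) -> E r = 0 ->
  E (fun w => sample_var k (dd_update x j l (r w)))
  = sample_var k (dd_update x j l 0) + E (fun w => r w ^ 2) / INR k.
Proof.
  intros Hk Hl Hr Hr2 Er; destruct (INR_neq0_pred_neq0 k Hk) as [HK HK1].
  set (y := dd_update x j l 0).
  transitivity (E (fun w => sample_var k y
                  + 2 * (y l - mean k y) / (INR k - 1) * r w + / INR k * r w ^ 2)).
  - f_equal; apply functional_extensionality; intros w.
    rewrite dd_update_as_add_at, sample_var_add_at by assumption.
    fold y; field; split; assumption.
  - rewrite E_quadratic, Er by assumption; field; split; assumption.
Qed.

Lemma avg_E_sample_var_dd_update k x (r : Omega -> R) :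
  (1 < k)%nat ->
  Int r -> Int (fun w => r w ^ 2) -> E r = 0 ->
  / INR k * sumR k (fun j => / INR k * sumR k (fun l =>
      E (fun w => sample_var k (dd_update x j l (r w)))))
  = (1 - 2 / INR k ^ 2) * sample_var k x + E (fun w => r w ^ 2) / INR k.
Proof.
  intros Hk Hr Hr2 Er; destruct (INR_neq0_pred_neq0 k Hk) as [HK _].
  rewrite <- avg_sample_var_copy by exact Hk.
  rewrite (sumR_ext k _ (fun j => / INR k * sumR k (fun l => sample_var k (dd_update x j l 0))
                                  + E (fun w => r w ^ 2) / INR k)).
  - rewrite sumR_plus, sumR_const; field; exact HK.
  - intros j _.
    rewrite (sumR_ext k _ (fun l => sample_var k (dd_update x j l 0)
                                    + E (fun w => r w ^ 2) / INR k))
      by (intros l Hl; apply E_sample_var_dd_update; assumption).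
    rewrite sumR_plus, sumR_const; field; exact HK.
Qed.

End Expectation.

Theorem theorem1 (k : nat) (sigma2 : R)
  (Omega1 : Type) (Int1 : (Omega1 -> R) -> Prop) (E1 : (Omega1 -> R) -> R)
  (Omega2 : Type) (Int2 : (Omega2 -> R) -> Prop) (E2 : (Omega2 -> R) -> R)
  (X : Omega1 -> nat -> R) (r : Omega2 -> R) :
  (2 <= k)%nat ->
  0 < sigma2 ->
  IsExpectation Int1 E1 ->
  IsExpectation Int2 E2 ->
  (forall u, (u < k)%nat -> Int1 (fun w => X w u)) ->
  (forall u v, (u < k)%nat -> (v < k)%nat -> Int1 (fun w => X w u * X w v)) ->
  Int2 r ->
  Int2 (fun w => r w ^ 2) ->
  E2 r = 0 ->
  E2 (fun w => r w ^ 2) - (E2 r) ^ 2 = sigma2 ->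
  E1 (fun w => sample_var k (X w)) = INR k / 2 * sigma2 ->
  E1 (fun w =>
        / INR k * sumR k (fun j =>
          / INR k * sumR k (fun l =>
            E2 (fun w' => sample_var k (dd_update (X w) j l (r w'))))))
  = INR k / 2 * sigma2.
Proof.
  intros Hk _ HE1 HE2 _ HXX Hr Hr2 Er Vr ES.
  destruct (INR_neq0_pred_neq0 k Hk) as [HK _].
  assert (Er2 : E2 (fun w => r w ^ 2) = sigma2) by (rewrite Er in Vr; lra).
  transitivity (E1 (fun w => (1 - 2 / INR k ^ 2) * sample_var k (X w) + sigma2 / INR k)).
  - f_equal; apply functional_extensionality; intros w.
    rewrite (avg_E_sample_var_dd_update _ _ _ HE2) by assumption.
    rewrite Er2; reflexivity.
  - rewrite (E_affine _ _ _ HE1) by (assumption || apply (int_sample_var _ _ _ HE1); assumption).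
    rewrite ES; field; exact HK.
Qed.
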